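(* Let $\mathcal A$ and $\mathcal B$ be graded connected locally finite Hopf algebras over $k$ which admit inner products $(\cdot,\cdot)_{\mathcal A}$ and $(\cdot,\cdot)_{\mathcal B}$ respectively. Then $\mathcal A$ and $\mathcal B$ are dual Hopf algebras (i.e., $\mathcal A^*\cong\mathcal B$) provided there is a degree-preserving linear map $\phi:\mathcal A\to\mathcal B$ such that, for all $a_1,a_2,a_3\in\mathcal A$, (a) $(a_1,a_2)_{\mathcal A}=(\phi(a_1),\phi(a_2))_{\mathcal B}$; (b) $(a_1a_2,a_3)_{\mathcal A}=(\phi(a_1)\otimes\phi(a_2),\Delta(\phi(a_3)))_{\mathcal B}$; (c) $(a_1\otimes a_2,\Delta(a_3))_{\mathcal A}=(\phi(a_1)\phi(a_2),\phi(a_3))_{\mathcal B}$.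
   Context: Here $k$ is a field of characteristic $0$. A graded connected Hopf algebra over $k$ is a Hopf algebra $\mathcal A=\bigoplus_{n\ge0}\mathcal A_n$ (associative, unital, not necessarily commutative; coassociative, counital) with $\mathcal A_n\mathcal A_m\subset\mathcal A_{n+m}$, $\mathcal A_0=k1$, the coproduct $\Delta$ a homomorphism of graded algebras, and the counit sending $1$ to $1$ and all positive-degree elements to $0$. It is locally finite if each $\mathcal A_n$ is finite-dimensional. $\mathcal A^*$ denotes the graded dual of $\mathcal A$, which is a Hopf algebra with multiplication $\Delta^*$ and coproduct $\mu^*$, where $\mu:\mathcal A\otimes\mathcal A\to\mathcal A$ is the product of $\mathcal A$. An inner product on a graded connected Hopf algebra $\mathcal A$ is a nondegenerate symmetric linear function $(\cdot,\cdot):\mathcal A\otimes\mathcal A\to k$ (i.e. a nondegenerate symmetric bilinear form on $\mathcal A$) such that $(a,b)=0$ for homogeneous $a,b\in\mathcal A$ of different degrees. It is extended to $\mathcal A\otimes\mathcal A$ by $(a\otimes a',b\otimes b')=(a,b)(a',b')$, and this extension is denoted by the same symbol.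
   Formalization: The map φ is additionally assumed surjective; without this the claim is false (A = k, B = k[x] with x primitive, (x^m,x^n) = n! if m = n and 0 otherwise, φ the unit map), and surjectivity is forced whenever A* ≅ B as graded Hopf algebras. *)

(* Defs.v *)
From HB Require Import structures.
From mathcomp Require Import all_boot all_order all_algebra.
From mathcomp Require Import boolp classical_sets functions.

Set Implicit Arguments.
Unset Strict Implicit.
Unset Printing Implicit Defensive.

Import GRing.Theory.
Local Open Scope ring_scope.
Local Open Scope quotient_scope.

Reserved Notation "x \ox y" (at level 40, left associativity).

(* A finite list of pairs stands for the sum of the corresponding pure tensors;
   two lists are identified when every bilinear map takes the same value on
   both, so the universal property holds by construction. *)
Section Tensor.
Variables (k : fieldType) (V W : lmodType k).
Implicit Types (U : lmodType k) (s : seq (V * W)).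

Definition tens_eval U (f : V -> W -> U) s : U := \sum_(p <- s) f p.1 p.2.

Definition tens_rel : rel (seq (V * W)) := fun s s' =>
  `[< forall U (f : {bilinear V -> W -> U}), tens_eval f s = tens_eval f s' >].

Lemma tens_rel_refl : reflexive tens_rel.
Proof. by move=> s; apply/asboolP. Qed.

Lemma tens_rel_sym : symmetric tens_rel.
Proof. by move=> s s'; apply/asboolP/asboolP => H U f; rewrite H. Qed.

Lemma tens_rel_trans : transitive tens_rel.
Proof.
move=> s1 s0 s2 /asboolP H1 /asboolP H2; apply/asboolP => U f.
by rewrite H1.
Qed.

Canonical tens_equiv :=
  EquivRel tens_rel tens_rel_refl tens_rel_sym tens_rel_trans.

Definition tens := {eq_quot tens_equiv}.
HB.instance Definition _ := Choice.on tens.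
HB.instance Definition _ := EqQuotient.on tens.

Definition pure (x : V) (y : W) : tens := \pi_tens [:: (x, y)].

(* The linear map induced by f on the tensor product. Only meaningful when f is
   bilinear; otherwise the value depends on the choice of representative. *)
Definition tens_lift U (f : V -> W -> U) (t : tens) : U :=
  tens_eval f (repr t).

Lemma tens_eval_repr U (f : {bilinear V -> W -> U}) s :
  tens_eval f (repr (\pi_tens s)) = tens_eval f s.
Proof.
have /asboolP -> // : tens_rel (repr (\pi_tens s)) s.
by apply/eqmodP; rewrite reprK.
Qed.

Lemma tens_ext (t u : tens) :
  (forall U (f : {bilinear V -> W -> U}), tens_lift f t = tens_lift f u) ->
  t = u.
Proof.
move=> H; rewrite -[t]reprK -[u]reprK; apply/eqmodP.
exact/asboolP.
Qed.

Definition tens_scale (c : k) (t : tens) : tens :=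
  \pi_tens [seq (c *: p.1, p.2) | p <- repr t].
Definition tens_zero : tens := \pi_tens [::].
Definition tens_opp (t : tens) : tens := tens_scale (- 1) t.
Definition tens_add (t u : tens) : tens := \pi_tens (repr t ++ repr u).

Section LiftOps.
Variables (U : lmodType k) (f : {bilinear V -> W -> U}).

Lemma tens_lift_add t u :
  tens_lift f (tens_add t u) = tens_lift f t + tens_lift f u.
Proof. by rewrite /tens_lift tens_eval_repr /tens_eval big_cat. Qed.

Lemma tens_lift_zero : tens_lift f tens_zero = 0.
Proof. by rewrite /tens_lift tens_eval_repr /tens_eval big_nil. Qed.

Lemma tens_lift_scale c t : tens_lift f (tens_scale c t) = c *: tens_lift f t.
Proof.
rewrite /tens_lift tens_eval_repr /tens_eval big_map scaler_sumr.
by apply: eq_bigr => p _ /=; rewrite linearZl_LR.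
Qed.

Lemma tens_lift_opp t : tens_lift f (tens_opp t) = - tens_lift f t.
Proof. by rewrite tens_lift_scale scaleN1r. Qed.

End LiftOps.

Lemma tens_addA : associative tens_add.
Proof.
by move=> t u v; apply: tens_ext => U f; rewrite !tens_lift_add addrA.
Qed.
Lemma tens_addC : commutative tens_add.
Proof. by move=> t u; apply: tens_ext => U f; rewrite !tens_lift_add addrC. Qed.
Lemma tens_add0 : left_id tens_zero tens_add.
Proof.
by move=> t; apply: tens_ext => U f; rewrite tens_lift_add tens_lift_zero add0r.
Qed.
Lemma tens_addN : left_inverse tens_zero tens_opp tens_add.
Proof.
move=> t; apply: tens_ext => U f.
by rewrite tens_lift_add tens_lift_opp tens_lift_zero addNr.
Qed.

HB.instance Definition _ :=
  GRing.isZmodule.Build tens tens_addA tens_addC tens_add0 tens_addN.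

Lemma tens_scaleA a b t : tens_scale a (tens_scale b t) = tens_scale (a * b) t.
Proof. by apply: tens_ext => U f; rewrite !tens_lift_scale scalerA. Qed.
Lemma tens_scale1 : left_id 1 tens_scale.
Proof. by move=> t; apply: tens_ext => U f; rewrite tens_lift_scale scale1r. Qed.
Lemma tens_scaleDr : right_distributive tens_scale +%R.
Proof.
move=> a t u; apply: tens_ext => U f.
by rewrite !(tens_lift_scale, tens_lift_add) scalerDr.
Qed.
Lemma tens_scaleDl t : {morph tens_scale^~ t : a b / a + b}.
Proof.
move=> a b; apply: tens_ext => U f.
by rewrite !(tens_lift_scale, tens_lift_add) scalerDl.
Qed.

HB.instance Definition _ := GRing.Zmodule_isLmodule.Build k tens
  tens_scaleA tens_scale1 tens_scaleDr tens_scaleDl.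

Section LiftTheory.
Variables (U : lmodType k) (f : {bilinear V -> W -> U}).

Lemma tens_lift_is_linear : linear (tens_lift f).
Proof. by move=> c t u; rewrite tens_lift_add tens_lift_scale. Qed.

HB.instance Definition _ :=
  GRing.isLinear.Build k tens U *:%R (tens_lift f) tens_lift_is_linear.

Lemma tens_lift_pure x y : tens_lift f (pure x y) = f x y.
Proof. by rewrite /tens_lift tens_eval_repr /tens_eval big_seq1. Qed.

End LiftTheory.

Lemma pure_bilinear : bilinear_for *:%R *:%R pure.
Proof.
split=> [y | x] c z z'; apply: tens_ext => U f /=;
    rewrite tens_lift_is_linear !tens_lift_pure.
  exact: linearPl.
exact: linearPr.
Qed.

HB.instance Definition _ :=
  bilinear_isBilinear.Build k V W tens *:%R *:%R pure pure_bilinear.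

Lemma tens_lift_linear U (f : V -> W -> U) :
  bilinear_for *:%R *:%R f -> linear (tens_lift f).
Proof.
move=> fb; pose f' : {bilinear V -> W -> U} :=
  HB.pack_for {bilinear V -> W -> U} f (bilinear_isBilinear.Build k V W U
    *:%R *:%R f fb).
exact: (tens_lift_is_linear f').
Qed.

Lemma tens_liftE U (f : V -> W -> U) :
  bilinear_for *:%R *:%R f -> forall x y, tens_lift f (pure x y) = f x y.
Proof.
move=> fb; pose f' : {bilinear V -> W -> U} :=
  HB.pack_for {bilinear V -> W -> U} f (bilinear_isBilinear.Build k V W U
    *:%R *:%R f fb).
exact: (tens_lift_pure f').
Qed.

Lemma tens_lift_sum U (f : V -> W -> U) :
  bilinear_for *:%R *:%R f -> forall (I : Type) (r : seq I) (F : I -> tens),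
  tens_lift f (\sum_(i <- r) F i) = \sum_(i <- r) tens_lift f (F i).
Proof.
move=> fb I r F; pose f' : {bilinear V -> W -> U} :=
  HB.pack_for {bilinear V -> W -> U} f (bilinear_isBilinear.Build k V W U
    *:%R *:%R f fb).
exact: (linear_sum (tens_lift f')).
Qed.

Lemma tens_sum_pure (t : tens) : t = \sum_(p <- repr t) pure p.1 p.2.
Proof.
apply: tens_ext => U f; rewrite linear_sum.
by apply: eq_bigr => p _; rewrite /= tens_lift_pure.
Qed.

Lemma tens_lift_unique U (f : {bilinear V -> W -> U})
    (g : {linear tens -> U}) :
  (forall x y, g (pure x y) = f x y) -> g =1 tens_lift f.
Proof.
move=> gf t; rewrite [t in LHS]tens_sum_pure linear_sum.
by apply: eq_bigr => p _; rewrite gf.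
Qed.

End Tensor.

Notation "x \ox y" := (pure x y) : ring_scope.

Section TensorMaps.
Variable k : fieldType.

Definition tens_map (V V' W W' : lmodType k) (f : V -> V') (g : W -> W') :
    tens V W -> tens V' W' :=
  tens_lift (fun x y => f x \ox g y).

Definition tens_assoc (V W X : lmodType k) :
    tens (tens V W) X -> tens V (tens W X) :=
  tens_lift (fun t z => tens_lift (fun x y => x \ox (y \ox z)) t).

Definition tens_mul (A : algType k) (t u : tens A A) : tens A A :=
  tens_lift (fun a a' => tens_lift (fun b b' => (a * b) \ox (a' * b')) u) t.

Definition tens_form (V : lmodType k) (form : V -> V -> k) (t u : tens V V) :
    k^o :=
  tens_lift (fun a a' =>
    tens_lift (fun b b' => (form a b * form a' b' : k^o)) u) t.

Definition tens_grade (V : lmodType k) (gr : nat -> {pred V}) (n : nat)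
    (t : tens V V) : Prop :=
  exists s : seq (V * V), t = \sum_(p <- s) p.1 \ox p.2 /\
    forall p, p \in s ->
      exists i j, [/\ (i + j)%N = n, p.1 \in gr i & p.2 \in gr j].

End TensorMaps.

Record gchopf (k : fieldType) := GCHopf {
  hopf_alg :> algType k;
  grade : nat -> {pred hopf_alg};
  comul : {linear hopf_alg -> tens hopf_alg hopf_alg};
  counit : {lrmorphism hopf_alg -> k^o};
  antipode : {linear hopf_alg -> hopf_alg};
  grade_submod : forall n, submod_closed (grade n);
  grade_sum : forall a, exists (N : nat) (s : nat -> hopf_alg),
    (forall n, s n \in grade n) /\ a = \sum_(n < N) s n;
  grade_direct : forall (N : nat) (s : nat -> hopf_alg),
    (forall n, s n \in grade n) -> \sum_(n < N) s n = 0 ->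
    forall n, (n < N)%N -> s n = 0;
  grade_mul : forall m n a b,
    a \in grade m -> b \in grade n -> a * b \in grade (m + n);
  grade_connected : forall a, a \in grade 0 <-> exists c : k, a = c%:A;
  comul_grade : forall n a, a \in grade n -> tens_grade grade n (comul a);
  comul1 : comul 1 = 1 \ox 1;
  comulM : forall a b, comul (a * b) = tens_mul (comul a) (comul b);
  comulA : forall a,
    tens_assoc (tens_map comul idfun (comul a)) =
    tens_map idfun comul (comul a);
  counitl : forall a, tens_lift (fun x y => counit x *: y) (comul a) = a;
  counitr : forall a, tens_lift (fun x y => counit y *: x) (comul a) = a;
  counit_pos : forall n a, (0 < n)%N -> a \in grade n -> counit a = 0;
  antipodel : forall a,
    tens_lift (fun x y => antipode x * y) (comul a) = (counit a)%:A;
  antipoder : forall a,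
    tens_lift (fun x y => x * antipode y) (comul a) = (counit a)%:A
}.

Definition locally_finite (k : fieldType) (A : gchopf k) : Prop :=
  forall n, exists s : seq A, {subset s <= grade n} /\
    forall a : A, a \in grade n ->
      exists c : nat -> k, a = \sum_(i < size s) c i *: s`_i.

Definition inner_product (k : fieldType) (A : gchopf k)
    (form : {symmetric A}) : Prop :=
  (forall a, (forall b, form a b = 0) -> a = 0) /\
  (forall m n a b, m != n -> a \in grade m -> b \in grade n -> form a b = 0).

Section GradedDual.
Variables (k : fieldType) (A : gchopf k).

Definition gdual_pred : {pred A -> k^o} := fun f =>
  `[< linear f /\ exists N, forall n a, (N <= n)%N -> a \in grade n -> f a = 0 >].

Let fctD (c : k) (f g : A -> k^o) a : (c *: f + g) a = c *: f a + g a.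
Proof. by []. Qed.

Lemma gdual_submod : submod_closed gdual_pred.
Proof.
split=> [|c f g /asboolP[fl [N fN]] /asboolP[gl [M gM]]]; apply/asboolP; split.
- by move=> c a b; rewrite /GRing.zero /= scaler0 addr0.
- by exists 0.
- move=> d a b; rewrite !fctD fl gl !scalerDr !scalerA mulrC.
  exact: addrACA.
- exists (maxn N M) => n a; rewrite geq_max => /andP[leN leM] an.
  by rewrite fctD (fN n) // (gM n) // scaler0 addr0.
Qed.

HB.instance Definition _ := GRing.isSubmodClosed.Build k (A -> k^o) gdual_pred
  gdual_submod.

Record gdual := GDual { gdual_fun :> A -> k^o; _ : gdual_fun \in gdual_pred }.
HB.instance Definition _ := [isSub for gdual_fun].
HB.instance Definition _ := [Choice of gdual by <:].
HB.instance Definition _ := [SubChoice_isSubLmodule of gdual by <:].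


Lemma gdual_linear (f : gdual) : linear f.
Proof. by case: f => f /= /asboolP[]. Qed.

HB.instance Definition _ (f : gdual) :=
  GRing.isLinear.Build k A k^o *:%R f (gdual_linear f).

Lemma gdual_bounded (f : gdual) :
  exists N, forall n a, (N <= n)%N -> a \in grade n -> f a = 0.
Proof. by case: f => f /= /asboolP[]. Qed.

Lemma gdual_ext (f g : gdual) : f =1 g -> f = g.
Proof. by move=> fg; apply/val_inj/funext. Qed.

Lemma gdualP (c : k) (f g : gdual) a : (c *: f + g) a = c * f a + g a.
Proof. by []. Qed.

(* (f (x) g)(u) for u in A (x) A. *)
Definition gdual_prod (f g : A -> k^o) (u : tens A A) : k^o :=
  tens_lift (fun a b => (f a * g b : k^o)) u.

Lemma gdual_prod_bilinear (f g : {linear A -> k^o}) :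
  bilinear_for *:%R *:%R (fun a b => (f a * g b : k^o)).
Proof.
split=> [b | a] c x y /=; rewrite linearP.
  by rewrite mulrDl scalerAl.
by rewrite mulrDr scalerAr.
Qed.

Definition gdual_mul_fun (f g : gdual) : A -> k^o :=
  fun a => gdual_prod f g (comul A a).

Lemma gdual_mul_subproof (f g : gdual) : gdual_mul_fun f g \in gdual_pred.
Proof.
have bfg := gdual_prod_bilinear f g.
apply/asboolP; split=> [c a b|].
  by rewrite /gdual_mul_fun linearP; apply: (tens_lift_linear bfg).
have [[N fN] [M gM]] := (gdual_bounded f, gdual_bounded g).
exists (N + M)%N => n a len /comul_grade[s [Ds sP]].
rewrite /gdual_mul_fun Ds /gdual_prod (tens_lift_sum bfg) big_seq big1 // => p.
move=> /sP[i [j [ijn pi pj]]].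
rewrite (tens_liftE bfg) /=.
have [lei|gti] := leqP N i; first by rewrite (fN i) // mul0r.
rewrite (gM j) ?mulr0 //; rewrite -ijn in len.
by rewrite -(leq_add2l N) (leq_trans len) // leq_add2r ltnW.
Qed.

Definition gdual_mul (f g : gdual) : gdual := GDual (gdual_mul_subproof f g).

Lemma gdual_one_subproof : (counit A : A -> k^o) \in gdual_pred.
Proof.
apply/asboolP; split; first exact: linearP.
by exists 1%N => n a n0; apply: counit_pos.
Qed.

Definition gdual_one : gdual := GDual gdual_one_subproof.

Definition gdual_counit (f : gdual) : k := f 1.

(* The bilinear form on A given by t in A^* (x) A^*. *)
Definition gdual_pair (t : tens gdual gdual) (a b : A) : k^o :=
  tens_lift (fun f g : gdual => (f a * g b : k^o)) t.

(* The coproduct dual to the product: gdual_pair_inj gives uniqueness of t, and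
   gdual_comulP gives existence when A is locally finite. *)
Definition gdual_comul (f : gdual) : tens gdual gdual :=
  xget 0 [set t | forall a b, gdual_pair t a b = f (a * b)]%classic.

Definition gdual_grade (n : nat) (f : gdual) : Prop :=
  forall m a, m != n -> a \in grade m -> f a = 0.

Lemma gdual_pair_bilinear (a b : A) :
  bilinear_for *:%R *:%R (fun f g : gdual => (f a * g b : k^o)).
Proof.
split=> [g | f] c x y.
  by rewrite -[LHS]/((c * x a + y a) * g b) mulrDl -mulrA.
by rewrite -[LHS]/(f a * (c * x b + y b)) mulrDr mulrCA.
Qed.

Lemma gdual0 a : (0 : gdual) a = 0. Proof. by []. Qed.

Lemma gdual_sum (I : Type) (r : seq I) (c : I -> k) (F : I -> gdual) a :
  (\sum_(i <- r) c i *: F i : gdual) a = \sum_(i <- r) c i * F i a.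
Proof.
elim: r => [|i r IHr]; first by rewrite !big_nil gdual0.
by rewrite !big_cons -IHr.
Qed.

Let pure_sum_eq0 (s : seq (gdual * gdual)) :
  (forall a b, \sum_(p <- s) p.1 a * p.2 b = 0) ->
  \sum_(p <- s) p.1 \ox p.2 = 0.
Proof.
have [n] := ubnP (size s); elim: n s => // n IHn [|[f g] s] /= lts H.
  by rewrite big_nil.
have [f0 | /existsNP[a /eqP fa0]] := pselect (forall a, f a = 0).
  have {}f0 : f = 0 by apply: gdual_ext.
  rewrite big_cons /= f0 linear0l add0r IHn // => a b.
  rewrite -[RHS](H a b) big_cons f0; apply/esym.
  by rewrite -[X in X + _]/(0 * g b) mul0r add0r.
have Dg : g = \sum_(p <- s) (- (p.1 a / f a)) *: p.2.
  apply: gdual_ext => b; rewrite gdual_sum; apply: (mulfI fa0).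
  have := H a b; rewrite big_cons /= => /eqP; rewrite addr_eq0 => /eqP ->.
  rewrite mulr_sumr -sumrN; apply: eq_bigr => p _.
  by rewrite mulrA mulrN mulrCA divff // mulr1 mulNr.
pose h (p : gdual * gdual) : gdual := (- (p.1 a / f a)) *: f + p.1.
pose s' := [seq (h p, p.2) | p <- s].
have -> : \sum_(p <- (f, g) :: s) p.1 \ox p.2 = \sum_(p <- s') p.1 \ox p.2.
  rewrite big_cons /= {1}Dg linear_sumr big_map -big_split /=.
  by apply: eq_bigr => p _; rewrite linearPl linearZr_LR.
apply: IHn => [|x b]; first by rewrite size_map.
rewrite -[RHS](H x b) big_cons /= {1}Dg gdual_sum big_map mulr_sumr.
rewrite -big_split /=; apply: eq_bigr => p _.
by rewrite -[LHS]/((- (p.1 a / f a) * f x + p.1 x) * p.2 b) mulrDl mulrCA mulrA.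
Qed.

Lemma gdual_pair_inj (t u : tens gdual gdual) :
  (forall a b, gdual_pair t a b = gdual_pair u a b) -> t = u.
Proof.
move=> tu; apply/eqP; rewrite -subr_eq0; apply/eqP.
have {tu} : forall a b, gdual_pair (t - u) a b = 0.
  move=> a b; have blin := tens_lift_linear (gdual_pair_bilinear a b).
  have -> : t - u = (- 1) *: u + t by rewrite scaleN1r addrC.
  rewrite /gdual_pair blin scaleN1r addrC.
  by apply/eqP; rewrite subr_eq0; apply/eqP; exact: tu.
move: (t - u) => d d0; rewrite [d]tens_sum_pure; exact: pure_sum_eq0.
Qed.

Let grade0 n : 0 \in @grade k A n. Proof. by case: (grade_submod A n). Qed.

Let gradeP n c a b :
  a \in grade n -> b \in grade n -> c *: a + b \in @grade k A n.
Proof. by case: (grade_submod A n) => _; apply. Qed.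

Let decomposition (a : A) : {s : nat -> A | (forall n, s n \in grade n) /\
  exists N, (forall n, (N <= n)%N -> s n = 0) /\ a = \sum_(n < N) s n}.
Proof.
apply: cid; have [N [s [sg ->]]] := grade_sum a.
exists (fun n => if (n < N)%N then s n else 0); split.
  by move=> n; case: ifP.
exists N; split=> [n|]; first by rewrite ltnNge => ->.
by apply: eq_bigr => i _; rewrite ltn_ord.
Qed.

Let extend (u : nat -> A) K L : (K <= L)%N ->
  (forall i, (K <= i)%N -> u i = 0) -> \sum_(i < K) u i = \sum_(i < L) u i.
Proof.
move=> leKL u0; rewrite (big_ord_widen L u leKL) big_mkcond.
by apply: eq_bigr => i _; case: ltnP => // /u0.
Qed.

Let decomposition_unique (s t : nat -> A) N M :
  (forall n, s n \in grade n) -> (forall n, t n \in grade n) ->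
  (forall n, (N <= n)%N -> s n = 0) -> (forall n, (M <= n)%N -> t n = 0) ->
  \sum_(n < N) s n = \sum_(n < M) t n -> s =1 t.
Proof.
move=> sg tg s0 t0 st n.
pose d i := (- 1) *: t i + s i.
have dg i : d i \in grade i by apply: gradeP.
pose L := maxn n.+1 (maxn N M).
have dL : \sum_(i < L) d i = 0.
  rewrite big_split /= -scaler_sumr scaleN1r.
  rewrite -(@extend s N) -?(@extend t M) ?leq_max ?leqnn ?orbT //.
  by rewrite st addNr.
have := grade_direct dg dL; move/(_ n); rewrite leq_max leqnn => /(_ isT) /eqP.
by rewrite /d scaleN1r addrC subr_eq0 => /eqP.
Qed.

Let pr n (a : A) : A := sval (decomposition a) n.

Let prg n a : pr n a \in grade n.
Proof. by rewrite /pr; case: (decomposition a) => s [sg _] /=. Qed.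

Let prE (a : A) : exists N, (forall n, (N <= n)%N -> pr n a = 0) /\
  a = \sum_(n < N) pr n a.
Proof. by rewrite /pr; case: (decomposition a) => s [_ []] /=; eauto. Qed.

Let pr_unique (s : nat -> A) N a :
  (forall n, s n \in grade n) -> (forall n, (N <= n)%N -> s n = 0) ->
  a = \sum_(n < N) s n -> forall n, pr n a = s n.
Proof.
move=> sg s0 Da; have [M [p0 Dp]] := prE a.
by apply: (decomposition_unique _ _ p0 s0) => //; rewrite -Da -Dp.
Qed.

Let pr_homog m a n : a \in grade m -> pr n a = if n == m then a else 0.
Proof.
move=> am; apply: (@pr_unique (fun n => if n == m then a else 0) m.+1).
- by move=> i; case: eqP => [->|].
- by move=> i lti; rewrite gtn_eqF.
rewrite (bigD1 ord_max) //= eqxx big1 ?addr0 // => i.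
by rewrite -val_eqE /= => /negPf->.
Qed.

Let pr_linear n : linear (pr n).
Proof.
move=> c a b; have [[N [a0 Da]] [M [b0 Db]]] := (prE a, prE b).
pose L := maxn N M.
apply: (@pr_unique (fun n => c *: pr n a + pr n b) L) => [i|i|].
- exact: gradeP.
- by rewrite geq_max => /andP[/a0-> /b0->]; rewrite scaler0 addr0.
rewrite big_split -scaler_sumr /= {1}Da {1}Db.
by rewrite (@extend (pr^~ a) N L) ?(@extend (pr^~ b) M L) ?leq_max ?leqnn ?orbT.
Qed.

Let gdual_pr n (g : gdual) x : gdual_grade n g -> g x = g (pr n x).
Proof.
move=> gn; have [M [x0 Dx]] := prE x; pose L := maxn M n.+1.
have ltnL : (n < L)%N by rewrite leq_maxr.
rewrite {1}Dx (@extend (pr^~ x) M L) ?leq_maxl // linear_sum.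
rewrite (bigD1 (Ordinal ltnL)) //= big1 ?addr0 // => i.
by rewrite -val_eqE => /= neq; apply: gn neq (prg i x).
Qed.

Let coordinates (n : nat) : locally_finite A -> exists s : seq (gdual * A),
  (forall p, p \in s -> gdual_grade n p.1) /\
  {in grade n, forall a, a = \sum_(p <- s) p.1 a *: p.2}.
Proof.
move=> /(_ n)[s0 [s0g s0span]].
pose spans m := `[< exists e : 'I_m -> A, forall a, a \in grade n ->
  exists c : 'I_m -> k, a = \sum_i c i *: e i >].
have : exists m, spans m.
  exists (size s0); apply/asboolP; exists (fun i => s0`_i) => a /s0span[c ->].
  by exists (fun i => c i).
case/ex_minnP => m /asboolP[e espan] emin.
have efree (c : 'I_m -> k) : \sum_i c i *: e i = 0 -> forall j, c j = 0.
  move=> ce0 j; apply: contrapT => /eqP cj0.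
  case: m e espan emin c ce0 j cj0 => [|m] e espan emin c ce0 j cj0.
    by case: j cj0.
  suff /emin : spans m by rewrite ltnn.
  apply/asboolP; exists (fun i => e (lift j i)) => a /espan[d ->].
  exists (fun i => d (lift j i) - d j / c j * c (lift j i)).
  rewrite (bigD1_ord j) //=.
  have -> : e j = - (c j)^-1 *: \sum_i c (lift j i) *: e (lift j i).
    move: ce0; rewrite (bigD1_ord j) //= => /eqP; rewrite addrC addr_eq0 => /eqP ->.
    by rewrite scaleNr scalerN opprK scalerA mulVf // scale1r.
  rewrite scalerA scaler_sumr -big_split /=; apply: eq_bigr => i _.
  by rewrite scalerA -scalerDl addrC mulrN mulNr.
pose coord a := sval (cid (espan (pr n a) (prg n a))).
have coordE a : pr n a = \sum_i coord a i *: e i.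
  by rewrite /coord; case: cid.
have coord_unique a c : pr n a = \sum_i c i *: e i -> forall j, coord a j = c j.
  rewrite coordE => /eqP; rewrite -subr_eq0 -sumrB => /eqP Dc j.
  apply/eqP; rewrite -subr_eq0; apply/eqP.
  apply: (efree (fun j => coord a j - c j)).
  by rewrite -[RHS]Dc; apply: eq_bigr => i _; rewrite scalerBl.
have coord0 j a m' : m' != n -> a \in grade m' -> coord a j = 0.
  move=> neq am; apply: (coord_unique a (fun=> 0)).
  rewrite (pr_homog _ am) eq_sym (negPf neq) big1 // => i _.
  by rewrite scale0r.
have coord_mem j : (fun a => coord a j : k^o) \in gdual_pred.
  apply/asboolP; split=> [c a b|].
    apply: (coord_unique _ (fun j => c * coord a j + coord b j)).
    rewrite pr_linear !coordE scaler_sumr -big_split; apply: eq_bigr => i _ /=.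
    by rewrite scalerDl scalerA.
  by exists n.+1 => m' a ltm; apply: coord0; rewrite gtn_eqF.
exists [seq (GDual (coord_mem j), e j) | j <- enum 'I_m]; split.
  by move=> p /mapP[j _ ->] m' a; apply: coord0.
move=> a an; rewrite big_map big_enum /= -coordE.
by rewrite (pr_homog _ an) eqxx.
Qed.

Lemma gdual_comulP (f : gdual) a b : locally_finite A ->
  gdual_pair (gdual_comul f) a b = f (a * b).
Proof.
move=> Afin; have [N fN] := gdual_bounded f.
have Rmem (e : A) : (fun b => f (e * b)) \in gdual_pred.
  apply/asboolP; split=> [c x y|].
    by rewrite mulrDr -scalerAr gdual_linear.
  exists N => n y len yn; have [M [_ ->]] := prE e.
  have fl : f = gdual_fun f :> (A -> k^o) by [].
  rewrite mulr_suml (linear_sum f) big1 // => i _.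
  apply: (fN (i + n)%N); first by rewrite (leq_trans len) ?leq_addl.
  exact: grade_mul.
pose R e := GDual (Rmem e).
pose s n := sval (cid (coordinates n Afin)).
have sP n : (forall p, p \in s n -> gdual_grade n p.1) /\
    {in grade n, forall a, a = \sum_(p <- s n) p.1 a *: p.2}.
  by rewrite /s; case: cid.
pose t : tens gdual gdual := \sum_(n < N) \sum_(p <- s n) p.1 \ox R p.2.
have tP x y : gdual_pair t x y = f (x * y).
  have blin := gdual_pair_bilinear x y.
  rewrite /gdual_pair /t (tens_lift_sum blin).
  have -> : f (x * y) = \sum_(n < N) f (pr n x * y).
    have [M [x0 Dx]] := prE x; pose L := maxn N M.
    rewrite {1}Dx (@extend (pr^~ x) M L) ?leq_max ?leqnn ?orbT //.
    rewrite mulr_suml linear_sum.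
    rewrite (@big_ord_widen _ _ _ N L (fun n => f (pr n x * y))) ?leq_maxl //.
    rewrite [RHS]big_mkcond; apply: eq_bigr => i _; case: ltnP => // leNi.
    have [K [_ ->]] := prE y; rewrite mulr_sumr linear_sum big1 // => j _.
    apply: (fN (i + j)%N); first by rewrite (leq_trans leNi) ?leq_addr.
    exact: grade_mul.
  apply: eq_bigr => i _; rewrite (tens_lift_sum blin).
  rewrite {1}((sP i).2 _ (prg i x)) mulr_suml linear_sum.
  apply: eq_big_seq => p ps; rewrite (tens_liftE blin) /= -scalerAl linearZ.
  by congr (_ * _); apply: gdual_pr; apply: (sP i).1.
rewrite /gdual_comul; case: xgetP => [u _ //|/(_ t)].
by move/(_ tP).
Qed.

End GradedDual.

(* A^* and B are isomorphic as graded Hopf algebras. An isomorphism of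
   bialgebras automatically carries the antipode to the antipode. *)
Definition dual_hopf (k : fieldType) (A B : gchopf k) : Prop :=
  exists psi : {linear gdual A -> B},
    [/\ bijective psi,
        forall n f, gdual_grade n f <-> psi f \in grade n,
        psi (gdual_one A) = 1 /\
          (forall f g, psi (gdual_mul f g) = psi f * psi g),
        forall f, comul B (psi f) = tens_map psi psi (gdual_comul f) &
        forall f, counit B (psi f) = gdual_counit f].

(* Main.v *)
Require Import Defs.
From HB Require Import structures.
From mathcomp Require Import all_boot all_order all_algebra.
From mathcomp Require Import boolp classical_sets functions.

Set Implicit Arguments.
Unset Strict Implicit.
Unset Printing Implicit Defensive.

Import GRing.Theory.
Local Open Scope ring_scope.

(* The conditions make theta : B -> A^*, theta b = (b, phi(-))_B, an
   isomorphism: it is injective because phi is onto, and onto because the form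
   of A is nondegenerate on each finite-dimensional A_n, so that every f in A^*
   is (x, -)_A = (phi x, phi(-))_B for some x. By (c) theta is multiplicative
   and by (b) it is comultiplicative; the unit is then preserved because units
   are unique, and the counit because it pairs with the unit by degree. *)

Section TensorLift.
Variable k : fieldType.

(** Both lifts evaluate the same representative [repr t], so pointwise equality suffices even for
    maps that are not bilinear. *)
Lemma eq_tens_lift (V W U : lmodType k) (f g : V -> W -> U) :
  f =2 g -> tens_lift f =1 tens_lift g.
Proof. by move=> fg t; apply: eq_bigr => p _; apply: fg. Qed.

Lemma pure_map_bilinear (V V' W W' : lmodType k)
    (f : {linear V -> V'}) (g : {linear W -> W'}) :
  bilinear_for *:%R *:%R (fun x y => f x \ox g y).
Proof. by split=> [y|x] c z z' /=; rewrite linearP ?linearPl ?linearPr. Qed.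

Lemma tens_lift_map (V V' W W' U : lmodType k)
    (f : {linear V -> V'}) (g : {linear W -> W'}) (h : V' -> W' -> U) :
  bilinear_for *:%R *:%R h ->
  forall t,
    tens_lift h (tens_map f g t) = tens_lift (fun x y => h (f x) (g y)) t.
Proof.
move=> hb t; rewrite /tens_map [in LHS]/tens_lift /tens_eval.
have hbl := tens_lift_sum hb; rewrite [LHS]hbl.
by apply: eq_bigr => p _; rewrite (tens_liftE hb).
Qed.

Lemma tens_lift_pure_id (V W : lmodType k) (t : tens V W) :
  tens_lift (fun x y => x \ox y) t = t.
Proof. by rewrite [RHS]tens_sum_pure. Qed.

Lemma tens_mapK (V V' : lmodType k) (f : {linear V -> V'})
    (g : {linear V' -> V}) :
  cancel f g -> cancel (tens_map f f) (tens_map g g).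
Proof.
move=> fK t; rewrite [LHS](tens_lift_map _ _ (pure_map_bilinear g g)).
by rewrite -[RHS]tens_lift_pure_id; apply: eq_tens_lift => x y; rewrite !fK.
Qed.

End TensorLift.

Section SymmetricForm.
Variables (k : fieldType) (V : lmodType k) (form : {symmetric V}).

Lemma formC x y : form x y = form y x.
Proof. by have := hermC form x y; rewrite expr0 mul1r. Qed.

Lemma formPr x : linear (form x : V -> k^o).
Proof. by move=> c y z; rewrite linearPr. Qed.

Lemma formPl y : linear (form^~ y : V -> k^o).
Proof. by move=> c x z /=; rewrite linearPl. Qed.

Lemma form_sumr (I : Type) (r : seq I) (F : I -> V) x :
  form x (\sum_(i <- r) F i) = \sum_(i <- r) form x (F i).
Proof. exact: (linear_sum (form x : V -> k^o)). Qed.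

Lemma form_suml (I : Type) (r : seq I) (F : I -> V) y :
  form (\sum_(i <- r) F i) y = \sum_(i <- r) form (F i) y.
Proof. by rewrite formC form_sumr; apply: eq_bigr => i _; rewrite formC. Qed.

Lemma formZr c x y : form x (c *: y) = c * form x y.
Proof. by rewrite linearZr_LR. Qed.

Lemma formZl c x y : form (c *: x) y = c * form x y.
Proof. by rewrite formC formZr formC. Qed.

Lemma form_mul_bilinear x y :
  bilinear_for *:%R *:%R (fun u v => form x u * form y v : k^o).
Proof.
by split=> [v | u] c z z'; rewrite formPr ?mulrDl ?mulrDr -?mulrA // mulrCA.
Qed.

(** Substituting a pure tensor requires the inner lift to be bilinear in [a] and [a']. This turns
    (b) and (c) into single lifts, comparable by [eq_tens_lift]. *)
Lemma tens_form_purel x y t :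
  tens_form form (x \ox y) t =
    tens_lift (fun u v => form x u * form y v : k^o) t.
Proof.
have bil : bilinear_for *:%R *:%R (fun a a' =>
    tens_lift (fun u v => form a u * form a' v : k^o) t).
  split=> [a' | a] c z z'; rewrite /= /tens_lift /tens_eval scaler_sumr -big_split;
      apply: eq_bigr => p _ /=; rewrite formPl.
    by rewrite mulrDl -mulrA.
  by rewrite mulrDr mulrCA.
exact: (tens_liftE bil).
Qed.

End SymmetricForm.

Section InnerProduct.
Variables (k : fieldType) (A : gchopf k).

Lemma grade_ext (U : lmodType k) (f g : {linear A -> U}) :
  (forall n, {in grade n, f =1 g}) -> f =1 g.
Proof.
move=> fg a; have [N [s [sg ->]]] := grade_sum a; rewrite !linear_sum.
by apply: eq_bigr => i _; apply: fg (sg i).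
Qed.

Variable form : {symmetric A}.
Hypothesis form_inner : inner_product form.

(** A component of [x] in a degree [m] other than [n] pairs with degree [m] as [x] does, hence to
    zero, and is orthogonal to all other degrees; nondegeneracy kills it. *)
Lemma inner_grade x n :
  (forall m a, m != n -> a \in grade m -> form x a = 0) -> x \in grade n.
Proof.
move=> x0; have [form_nd form_orth] := form_inner.
have [N [s [sg Dx]]] := grade_sum x.
have s0 (m : 'I_N) : nat_of_ord m != n -> s m = 0.
  move=> neq; apply: form_nd.
  apply: (@grade_ext k^o (form (s m) : A -> k^o) \0) => p a ap /=.
  have [pm|neqp] := eqVneq p m; last first.
    by apply: form_orth (sg m) ap; rewrite eq_sym.
  transitivity (form x a); last by apply: (x0 p) ap; rewrite pm.
  rewrite Dx form_suml (bigD1 m) //= big1 ?addr0 // => i.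
  rewrite -val_eqE /= => neqi; apply: form_orth (sg i) ap.
  by rewrite pm.
have [grade0 gradeP] := grade_submod A n.
rewrite Dx; apply: (big_ind (fun y => y \in grade n)) => [//|y z yg zg|i _].
  by rewrite -[y]scale1r; apply: gradeP.
by have [<- //|/s0->] := eqVneq (nat_of_ord i) n.
Qed.

(* The Gram matrix G of a finite spanning set of A_n may be singular, but u in
   its kernel means that the combination y of the spanning set is orthogonal to
   A_n, hence y = 0 and f y = 0; so the row of values of f is in the row space
   of G. *)
Lemma inner_represent_grade n (f : gdual A) : locally_finite A ->
  exists2 x, x \in grade n & {in grade n, form x =1 f}.
Proof.
move=> /(_ n)[s [sg span]]; have [form_nd form_orth] := form_inner.
have [grade0 gradeP] := grade_submod A n.
have comb (c : 'I_(size s) -> k) : \sum_i c i *: s`_i \in grade n.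
  apply: (big_ind (fun y => y \in grade n)) => [//|y z yg zg|i _].
    by rewrite -[y]scale1r; apply: gradeP.
  by rewrite -[X in X \in _]addr0; apply: gradeP => //; apply/sg/mem_nth.
pose G := \matrix_(i < size s, j < size s) form s`_i s`_j.
pose v := \row_(j < size s) (f s`_j : k).
have /submxP[c Dc] : (v <= G)%MS.
  rewrite submxE; apply/eqP/rowP => j; rewrite !mxE.
  pose u i := cokermx G i j; pose y := \sum_i u i *: s`_i.
  have y0 : y = 0.
    apply: form_nd; apply: (@grade_ext k^o (form y : A -> k^o) \0) => m a am /=.
    have [mn|neq] := eqVneq m n; last first.
      by apply: form_orth (comb u) am; rewrite eq_sym.
    rewrite mn in am; have [d ->] := span a am.
    rewrite form_sumr big1 // => i _; rewrite formZr formC form_sumr.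
    have /matrixP/(_ i j) := mulmx_coker G; rewrite !mxE => G0.
    rewrite (_ : \sum_(i0 < _) _ = 0) ?mulr0 // -[RHS]G0.
    by apply: eq_bigr => l _; rewrite formZr mxE mulrC.
  rewrite -[RHS](linear0 f) -y0 linear_sum.
  by apply: eq_bigr => i _; rewrite linearZ mxE mulrC.
exists (\sum_i c 0 i *: s`_i) => [|a /span[d ->]]; first exact: comb.
rewrite form_sumr linear_sum; apply: eq_bigr => j _; rewrite formZr linearZ.
congr (_ * _); have /rowP/(_ j) := Dc; rewrite !mxE => fE; rewrite [RHS]fE.
by rewrite form_suml; apply: eq_bigr => i _; rewrite formZl mxE.
Qed.

(** [f] vanishes from some degree [N] on, so summing the representatives of degree below [N] is
    enough: by orthogonality only the summand [x m] is seen on degree [m]. *)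
Lemma inner_represent (f : gdual A) : locally_finite A ->
  exists x, form x =1 f.
Proof.
move=> Afin; have [_ form_orth] := form_inner.
have [N fN] := gdual_bounded f.
have /choice[x xP] n : exists x, x \in grade n /\ {in grade n, form x =1 f}.
  by have [x] := inner_represent_grade n f Afin; exists x.
exists (\sum_(n < N) x n).
apply: (@grade_ext k^o (form _ : A -> k^o) f) => m a am; rewrite /= form_suml.
have form0 (i : nat) : i != m -> form (x i) a = 0.
  by move=> neq; apply: form_orth neq (xP i).1 am.
have [ltmN|leNm] := ltnP m N.
  rewrite (bigD1 (Ordinal ltmN)) //= big1 ?addr0 => [|i].
    exact: (xP m).2.
  by rewrite -val_eqE; apply: form0.
rewrite (fN m) // big1 // => i _; apply: form0.
by rewrite neq_ltn (leq_trans (ltn_ord i) leNm).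
Qed.

End InnerProduct.

(** This is the left counit axiom of [A], read through [f]. *)
Lemma gdual_mul1l (k : fieldType) (A : gchopf k) (f : gdual A) :
  gdual_mul (gdual_one A) f = f.
Proof.
apply: gdual_ext => a; rewrite -[in RHS](counitl a).
rewrite [in RHS]/tens_lift /tens_eval linear_sum.
by apply: eq_bigr => p _; rewrite linearZ.
Qed.

Lemma inner_gdual_pred (k : fieldType) (A B : gchopf k) (form : {symmetric B})
    (phi : {linear A -> B}) (b : B) :
  inner_product form ->
  (forall n a, a \in grade n -> phi a \in grade n) ->
  (fun a => form b (phi a)) \in @gdual_pred k A.
Proof.
move=> [_ form_orth] phi_deg; apply/asboolP; split=> [c x y|].
  by rewrite linearP formPr.
have [N [s [sg ->]]] := grade_sum b; exists N => n a leNn an.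
rewrite form_suml big1 // => i _; apply: form_orth (sg i) (phi_deg _ _ an).
by rewrite neq_ltn (leq_trans (ltn_ord i) leNn).
Qed.

(* Surjectivity of phi is needed: for A = k and B = k[x] with x primitive and
   (x^m, x^n) = m! if m = n and 0 otherwise, the unit map k -> k[x] satisfies all the other
   hypotheses. *)
Theorem theorem2p1 (k : fieldType) (k_char0 : [pchar k] =i pred0)
  (A B : gchopf k) (A_fin : locally_finite A) (B_fin : locally_finite B)
  (formA : {symmetric A}) (formB : {symmetric B})
  (formA_inner : inner_product formA) (formB_inner : inner_product formB)
  (phi : {linear A -> B})
  (phi_deg : forall n a, a \in grade n -> phi a \in grade n)
  (phi_surj : forall b : B, exists a : A, phi a = b)
  (hyp_a : forall a1 a2 : A, formA a1 a2 = formB (phi a1) (phi a2))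
  (hyp_b : forall a1 a2 a3 : A,
    formA (a1 * a2) a3 =
    tens_form formB (phi a1 \ox phi a2) (comul B (phi a3)))
  (hyp_c : forall a1 a2 a3 : A,
    tens_form formA (a1 \ox a2) (comul A a3) =
    formB (phi a1 * phi a2) (phi a3)) :
  dual_hopf A B.
Proof.
have [ndB orthB] := formB_inner.
pose theta b := GDual (inner_gdual_pred b formB_inner phi_deg).
have theta_lin : linear theta.
  by move=> c x y; apply: gdual_ext => a; rewrite /= formPl.
pose Theta : {linear B -> gdual A} := HB.pack_for {linear B -> gdual A} theta
  (GRing.isLinear.Build k B (gdual A) *:%R theta theta_lin).
have thetaI : injective Theta.
  move=> b b' bb'; apply/eqP; rewrite -subr_eq0; apply/eqP; apply: ndB => c.
  have [a <-] := phi_surj c; have := linearB Theta b b'; rewrite bb' subrr.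
  by move/(congr1 (fun f : gdual A => f a)).
have /choice[rep repE] (f : gdual A) : exists x, formA x =1 f.
  exact: (inner_represent formA_inner f A_fin).
pose psi0 f := phi (rep f).
have psiK : cancel psi0 Theta.
  by move=> f; apply: gdual_ext => a; rewrite /= -hyp_a repE.
have thetaK : cancel Theta psi0 by apply: inj_can_sym psiK thetaI.
(* [rep] comes from choice; [psi0] is linear because it inverts the linear [Theta]. *)
pose psi : {linear gdual A -> B} := HB.pack_for {linear gdual A -> B} psi0
  (GRing.isLinear.Build k (gdual A) B *:%R psi0 (can2_linear thetaK psiK)).
have psiE f a : formB (psi f) (phi a) = f a.
  by rewrite -[in RHS](psiK f).
have psiM f g : psi (gdual_mul f g) = psi f * psi g.
  apply: thetaI; rewrite psiK; apply: gdual_ext => a /=.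
  rewrite -hyp_c tens_form_purel; apply: eq_tens_lift => x y.
  by rewrite !repE.
have psi1 : psi (gdual_one A) = 1.
  (* With [e] the unit of the dual: [psi e = psi e * psi (Theta 1) = psi (e * Theta 1) = psi (Theta
     1) = 1]. *)
  by rewrite -[LHS]mulr1 -[1 in LHS]thetaK -[LHS]psiM gdual_mul1l [LHS]thetaK.
have phi1_grade : phi 1 \in grade 0.
  by apply/phi_deg/grade_connected; exists 1; rewrite scale1r.
exists psi; split=> //.
- by exists Theta.
- move=> n f; split=> [fn|psin m a neq am].
    apply/phi_deg/(inner_grade formA_inner) => m a neq am.
    by rewrite repE (fn m).
  by rewrite -psiE; apply: orthB psin (phi_deg _ _ am); rewrite eq_sym.
(* Pulled back along [Theta] on both factors, the claim is tested on pairs [a], [b], where (b)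
   rewrites [f (a * b)], the pairing of [rep f] with [a * b]. *)
- move=> f; rewrite -[LHS](tens_mapK (f := Theta) (g := psi) thetaK).
  congr tens_map; apply: gdual_pair_inj => a b; rewrite gdual_comulP //.
  rewrite -repE formC hyp_b tens_form_purel.
  rewrite [LHS](tens_lift_map _ _ (gdual_pair_bilinear a b)).
  by apply: eq_tens_lift => x y /=; rewrite !(formC formB (phi _)).
move=> f; rewrite /gdual_counit -psiE formC; symmetry.
(* Pairing with [phi 1] is compared with the counit degree by degree: both vanish in positive
   degrees, and both send 1 to 1 since [psi] maps the counit of [A] to 1. *)
move: (psi f); apply: (@grade_ext _ _ k^o (formB (phi 1) : B -> k^o) (counit B)).
move=> [|n] b bn.
  have /grade_connected[c ->] := bn; rewrite /= formZr formC linearZ.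
  by rewrite -psi1 psiE psi1 /= !rmorph1.
by rewrite /= (counit_pos _ bn) // (orthB 0 n.+1).
Qed.
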